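(* Let $L\ge 1$ be the total number of indistinguishable attackable locations in a combined data-plus-verifier circuit, $L_v$ ($0\le L_v\le L$) the number of verifier (trap) locations, and $L_d=L-L_v$ the number of data locations. Suppose the adversary attacks $t$ distinct locations ($1\le t\le L$) in a single run before learning the hidden verifier placement, or more generally suppose that, conditioned on the server's view, the attacked set is independent of the hidden placement. Suppose the $L_v$ verifier locations are hidden uniformly among the $L$ attackable locations. Suppose that each attacked verifier location detects the deviation with probability at least $\delta\in[0,1]$, with missed detections bounded as follows: if exactly $h$ of the attacked locations are verifier locations, the probability that no deviation is detected is at most $(1-\delta)^h$. Then the single-run non-detection probability satisfies $$p_{\mathrm{nd}}(t)\le\sum_{h=h_{\min}}^{h_{\max}}\frac{\binom{L_v}{h}\binom{L-L_v}{t-h}}{\binom{L}{t}}(1-\delta)^h,\qquad h_{\min}=\max\{0,t-(L-L_v)\},\quad h_{\max}=\min\{t,L_v\},$$ where the hypergeometric factor is the probability that an attack on $t$ distinct locations hits exactly $h$ verifier locations. If $\delta=1$, then $$p_{\mathrm{nd}}(t)\le\frac{\binom{L-L_v}{t}}{\binom{L}{t}}\quad\text{when } t\le L-L_v,\qquad p_{\mathrm{nd}}(t)=0\quad\text{when } t>L-L_v,$$ and in this case $$\frac{\binom{L-L_v}{t}}{\binom{L}{t}}=\prod_{j=0}^{t-1}\frac{L-L_v-j}{L-j}\le\Bigl(1-\frac{L_v}{L}\Bigr)^t .$$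
   Context: Setting: a client delegates a compiled quantum execution to a server, with $L_v$ hidden verifier (trap) locations, whose correct outcomes the client can check, mixed among $L_d$ data locations by a secret random placement. $p_{\mathrm{nd}}(t)$ is the probability, in a single run, that an adversary attacking $t$ distinct locations is not detected by any verifier check. The convention $0^0=1$ is used. *)

(* Defs.v *)
From HB Require Import structures.
From mathcomp Require Import all_boot all_order all_algebra.
From mathcomp Require Import all_classical all_reals all_analysis.

Set Implicit Arguments.
Unset Strict Implicit.
Unset Printing Implicit Defensive.

Import Order.TTheory GRing.Theory Num.Theory.

Local Open Scope classical_set_scope.
Local Open Scope ring_scope.

Section probability_notions.
Context {R : realType} {d : measure_display} {T : measurableType d}.
Variable P : probability T R.

Definition prob (E : set T) : R := fine (P E).

(* Equals 0 when [P F = 0]; only used under the guard [0 < prob F]. *)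
Definition cond_prob (E F : set T) : R := prob (E `&` F) / prob F.

(* Measurability of a map to a finite type carrying the discrete
   sigma-algebra. *)
Definition discrete_rv (I : finType) (X : T -> I) : Prop :=
  forall x : I, measurable (X @^-1` [set x]).

Definition independent_rv (I J : finType) (X : T -> I) (Y : T -> J) : Prop :=
  forall x y, prob (X @^-1` [set x] `&` Y @^-1` [set y]) =
              prob (X @^-1` [set x]) * prob (Y @^-1` [set y]).

(* [f \o W] is a version of the conditional probability of [E] given the
   sigma-algebra generated by [W]. *)
Definition cond_prob_version (d' : measure_display) (S : measurableType d')
    (W : T -> S) (E : set T) (f : S -> R) : Prop :=
  [/\ measurable_fun setT f,
      forall s, 0 <= f s <= 1 &
      forall B : set S, measurable B ->
        (P (E `&` W @^-1` B) = \int[P]_(w in W @^-1` B) (f (W w))%:E)%E].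

Definition cond_independent_rv (d' : measure_display) (S : measurableType d')
    (W : T -> S) (I J : finType) (X : T -> I) (Y : T -> J) : Prop :=
  forall x y, exists f g : S -> R,
    [/\ cond_prob_version W (X @^-1` [set x]) f,
        cond_prob_version W (Y @^-1` [set y]) g &
        cond_prob_version W (X @^-1` [set x] `&` Y @^-1` [set y])
          (fun s => f s * g s)].

End probability_notions.

Section verifier_placement.
Context {R : realType} {d : measure_display} {T : measurableType d}.
Variables (P : probability T R) (L : nat).

(* Mass function of the uniform law on the [k]-element subsets of the [L]
   locations. *)
Definition uniform_subset_pmf (k : nat) (v : {set 'I_L}) : R :=
  if #|v| == k then ('C(L, k)%:R)^-1 else 0.

Definition uniform_placement (Lv : nat) (V : T -> {set 'I_L}) : Prop :=
  forall v, prob P (V @^-1` [set v]) = uniform_subset_pmf Lv v.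

(* The placement stays uniform conditionally on the view [W], that is, [W]
   reveals nothing about it. *)
Definition uniform_placement_given (d' : measure_display)
    (S : measurableType d') (W : T -> S) (Lv : nat) (V : T -> {set 'I_L}) :
    Prop :=
  forall v, cond_prob_version P W (V @^-1` [set v])
              (fun=> uniform_subset_pmf Lv v).

Definition attacked_verifier (A V : T -> {set 'I_L}) (i : 'I_L) : set T :=
  [set w | i \in A w :&: V w].

Definition verifier_hits (A V : T -> {set 'I_L}) (h : nat) : set T :=
  [set w | #|A w :&: V w| = h].

(* [D i] is the event that a check performed at location [i] flags a
   deviation; it only counts when [i] is a verifier location. *)
Definition undetected (V : T -> {set 'I_L}) (D : 'I_L -> set T) : set T :=
  [set w | forall i, i \in V w -> ~ D i w].

End verifier_placement.

Definition hmin (L Lv t : nat) : nat := maxn 0 (t - (L - Lv)).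
Definition hmax (Lv t : nat) : nat := minn t Lv.

Definition hypergeom {R : realType} (L Lv t h : nat) : R :=
  ('C(Lv, h)%:R * 'C(L - Lv, t - h)%:R) / 'C(L, t)%:R.

(* Main.v *)
(** Conditioning on the view adds nothing: the conditional law of the placement
    is constant, so integrating the conditional independence over all views
    gives back plain independence of [A] and [V]. For a fixed attacked set of
    size [t], the number of [Lv]-subsets meeting it in [h] points is
    ['C(t, h) * 'C(L - t, Lv - h)]; divided by ['C(L, Lv)] this is the
    hypergeometric weight, by the symmetry between the two subsets. The bound
    then follows by splitting on the number of hits, and at [delta = 1] only
    the term [h = 0] survives. *)
Require Import Defs.
From HB Require Import structures.
From mathcomp Require Import all_boot all_order all_algebra.
From mathcomp Require Import all_classical all_reals all_analysis.
From mathcomp Require Import measurable_realfun zify ring.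

Set Implicit Arguments.
Unset Strict Implicit.
Unset Printing Implicit Defensive.

Import Order.TTheory GRing.Theory Num.Theory.

Local Open Scope classical_set_scope.
Local Open Scope ring_scope.

(** * Falling factorials and binomial identities *)

Lemma natr_ffact (R : comPzRingType) (n t : nat) :
  (n ^_ t)%:R = \prod_(0 <= j < t) (n%:R - j%:R) :> R.
Proof.
elim: t => [|t IH]; first by rewrite ffactn0 big_nil.
rewrite ffactnSr natrM big_nat_recr //= -IH.
(* The subtraction [n - t] truncates in the naturals but not in the ring; once [n < t] the falling
   factorial is already zero, so both sides agree. *)
have [tn|nt] := leqP t n; first by rewrite natrB.
by rewrite ffact_small // !mul0r.
Qed.

Lemma bin_ratio_prod (R : numFieldType) (n m t : nat) : (t <= m)%N ->
  'C(n, t)%:R / 'C(m, t)%:R =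
    \prod_(0 <= j < t) ((n%:R - j%:R) / (m%:R - j%:R)) :> R.
Proof.
move=> tm; rewrite big_split /= prodfV -!natr_ffact -!bin_ffact !natrM.
by rewrite -mulf_div divff ?mulr1 // pnatr_eq0 -lt0n fact_gt0.
Qed.

(** Subtracting the same [j] from [n <= m] can only lower the ratio, so each factor is at most
    [n / m]. Termwise comparison needs nonnegative factors, hence the separate case [n < t], where
    the product is zero. *)
Lemma prod_ratio_le_expr (R : numFieldType) (n m t : nat) :
    (n <= m)%N -> (t <= m)%N ->
  \prod_(0 <= j < t) ((n%:R - j%:R) / (m%:R - j%:R)) <=
    (n%:R / m%:R) ^+ t :> R.
Proof.
move=> nm tm; have [tn|nt] := leqP t n; last first.
  rewrite -bin_ratio_prod // bin_small // mul0r.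
  by rewrite exprn_ge0 // divr_ge0.
rewrite -[in leRHS](subn0 t) -prodr_const_nat !big_nat.
apply: ler_prod => j /= jt.
have jm : (j < m)%N by rewrite (leq_trans jt).
have jn : (j < n)%N by rewrite (leq_trans jt).
have m0 : 0 < m%:R :> R by rewrite ltr0n (leq_trans _ jm).
have mj0 : 0 < m%:R - j%:R :> R by rewrite subr_gt0 ltr_nat.
rewrite divr_ge0 ?subr_ge0 ?ler_nat 1?ltnW //=.
rewrite ler_pdivrMr // mulrAC ler_pdivlMr // mulrBl mulrBr lerB //.
by rewrite [in leRHS]mulrC ler_wpM2r // ler_nat.
Qed.

(** Double counting of pairs of a [t]-subset and a [k]-subset sharing [h] points: either subset may
    be chosen first. The proof uses the four cells [h], [a], [b], [c] (both, first only, second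
    only, neither): multiplied by the factorials of the cells, each side becomes [n!]. *)
Lemma mul_bin_hypergeometric (n k t h : nat) :
    (h <= k)%N -> (h <= t)%N -> (k <= n)%N -> (t <= n)%N ->
  ('C(t, h) * 'C(n - t, k - h) * 'C(n, t) =
   'C(k, h) * 'C(n - k, t - h) * 'C(n, k))%N.
Proof.
move=> hk ht kn tn.
(* Here the fourth cell would have negative size; both sides are zero. *)
have [small|big] := ltnP (n - t) (k - h).
  have small' : (n - k < t - h)%N by lia.
  by rewrite (bin_small small) (bin_small small') !muln0.
have [b Eb] : exists b, k = (h + b)%N by exists (k - h)%N; lia.
have [a Ea] : exists a, t = (h + a)%N by exists (t - h)%N; lia.
have [c Ec] : exists c, n = (h + a + b + c)%N.
  by exists (n - (h + a + b))%N; lia.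
have := bin_fact ht; have := bin_fact hk.
have := bin_fact tn; have := bin_fact kn.
have := @bin_fact (n - t) (k - h) big.
have := @bin_fact (n - k) (t - h) ltac:(lia).
have -> : (n - k - (t - h) = c)%N by lia.
have -> : (n - t - (k - h) = c)%N by lia.
have -> : (n - t = b + c)%N by lia.
have -> : (n - k = a + c)%N by lia.
have -> : (t - h = a)%N by lia.
have -> : (k - h = b)%N by lia.
move=> E1 E2 E3 E4 E5 E6.
have pos : (0 < h`! * a`! * b`! * c`!)%N by rewrite !muln_gt0 !fact_gt0.
apply/eqP; rewrite -(eqn_pmul2r pos); apply/eqP.
transitivity n`!.
  by rewrite -E4 -E6 -E2; ring.
by rewrite -E3 -E5 -E1; ring.
Qed.

(** Such a [Y] splits uniquely into an [h]-subset of [X] and a [(k - h)]-subset of its complement;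
    the sets counted are the injective image of these pairs under union. *)
Lemma card_draws_meet (I : finType) (X : {set I}) (k h : nat) : (h <= k)%N ->
  #|[set Y : {set I} | (#|Y| == k) && (#|X :&: Y| == h)]%SET| =
    ('C(#|X|, h) * 'C(#|I| - #|X|, k - h))%N.
Proof.
move=> hk; have -> : (#|I| - #|X| = #|~: X|)%N.
  by rewrite [RHS]cardsCs finset.setCK.
rewrite -!cards_draws -cardsX.
rewrite -(@card_in_imset _ _ (fun p => p.1 :|: p.2)%SET).
  apply: eq_card => Y; rewrite finset.inE; apply/andP/imsetP.
    move=> [/eqP Yk /eqP Yh]; exists (X :&: Y, ~: X :&: Y)%SET; last first.
      by rewrite /= -finset.setIUl finset.setUCr finset.setTI.
    rewrite !finset.inE /= !finset.subsetIl Yh eqxx /=.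
    rewrite finset.setIC -finset.setDE -Yk -Yh -(cardsID X Y).
    by rewrite (finset.setIC Y) addKn.
  move=> [[B C]]; rewrite !finset.inE /= =>
    /andP[/andP[BX /eqP Bh] /andP[CX /eqP Ch]] ->.
  have XB : (X :&: (B :|: C) = B)%SET.
    rewrite finset.setIUr (finset.setIidPr BX).
    have -> : (X :&: C = finset.set0)%SET; last by rewrite finset.setU0.
    by apply/eqP; rewrite finset.setI_eq0 disjoint_sym finset.disjoints_subset.
  split; last by rewrite XB Bh.
  rewrite cardsU Bh Ch.
  have -> : (B :&: C = finset.set0)%SET; last by rewrite cards0 subn0 subnKC.
  apply/eqP; rewrite finset.setI_eq0 disjoint_sym finset.disjoints_subset.
  by rewrite (fintype.subset_trans CX) // finset.setCS.
(* Injectivity: intersecting the union with [X] and with its complement recovers the two pieces. *)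
have meet (B C : {set I}) : (B \subset X)%SET -> (C \subset ~: X)%SET ->
    (X :&: (B :|: C) = B)%SET /\ (~: X :&: (B :|: C) = C)%SET.
  move=> BX CX; split; apply/finset.setP => i; rewrite !finset.inE.
    have /implyP := fintype.subsetP BX i; have /implyP := fintype.subsetP CX i.
    by rewrite finset.inE; case: (i \in X); case: (i \in B); case: (i \in C).
  have /implyP := fintype.subsetP BX i; have /implyP := fintype.subsetP CX i.
  by rewrite finset.inE; case: (i \in X); case: (i \in B); case: (i \in C).
move=> [B C] [B' C']; rewrite !finset.inE /=.
move=> /andP[/andP[BX _] /andP[CX _]] /andP[/andP[BX' _] /andP[CX' _]] E.
have [E1 E2] := meet _ _ BX CX; have [E1' E2'] := meet _ _ BX' CX'.
by congr (_, _); [rewrite -E1 E E1'|rewrite -E2 E E2'].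
Qed.

(** * Finite-valued random variables and conditioning on a view *)

Section discrete_variables.
Context {R : realType} {d : measure_display} {T : measurableType d}.
Variable P : probability T R.

Lemma prob_ge0 (E : set T) : 0 <= prob P E.
Proof. exact/fine_ge0/measure_ge0. Qed.

Lemma prob_mono (E F : set T) : measurable E -> measurable F ->
  E `<=` F -> prob P E <= prob P F.
Proof.
move=> mE mF EF; rewrite fine_le ?fin_num_measure //.
by rewrite le_measure ?inE.
Qed.

Lemma discrete_rv_preimage (I : finType) (X : T -> I) (B : set I) :
  discrete_rv X -> measurable (X @^-1` B).
Proof.
move=> mX; have -> : X @^-1` B = \bigcup_(x in B) X @^-1` [set x].
  by apply/seteqP; split=> [w Bw|w [x Bx /= Xw]]; [exists (X w)|rewrite /= Xw].
by apply: fin_bigcup_measurable => // x _; exact: mX.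
Qed.

Lemma discrete_rv_comp (I J : finType) (X : T -> I) (f : I -> J) :
  discrete_rv X -> discrete_rv (f \o X).
Proof. by move=> mX y; exact: (discrete_rv_preimage (f @^-1` [set y]) mX). Qed.

Lemma discrete_rv_pair (I J : finType) (X : T -> I) (Y : T -> J) :
  discrete_rv X -> discrete_rv Y -> discrete_rv (fun w => (X w, Y w)).
Proof.
move=> mX mY [x y].
have -> : (fun w => (X w, Y w)) @^-1` [set (x, y)] =
          X @^-1` [set x] `&` Y @^-1` [set y].
  by apply/seteqP; split=> w /=; [case=> -> ->|case=> -> ->].
exact: measurableI.
Qed.

Lemma prob_total (I : finType) (X : T -> I) (E : set T) :
    discrete_rv X -> measurable E ->
  prob P E = \sum_x prob P (E `&` X @^-1` [set x]).
Proof.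
move=> mX mE; have mEX x : measurable (E `&` X @^-1` [set x]).
  exact: measurableI.
have EU : E = \bigcup_x (E `&` X @^-1` [set x]).
  by apply/seteqP; split=> [w Ew|w [x _ []//]]; exists (X w).
apply: EFin_inj; rewrite -sumEFin /prob fineK ?fin_num_measure //.
rewrite {1}EU measure_fin_bigcup //; first last.
- by move=> x y _ _ [w [[_ /= <-] [_ /= <-]]].
- exact: finite_finset.
under [RHS]eq_bigr do rewrite fineK ?fin_num_measure //.
rewrite -[RHS]big_enum /= [RHS]fsbig_seq ?enum_uniq //.
suff -> : [set` enum I] = [set: I] by [].
by apply/seteqP; split=> x //= _; rewrite mem_enum.
Qed.

Lemma prob_bigID (I : finType) (X : T -> I) (p : pred I) :
    discrete_rv X ->
  prob P (X @^-1` [set x | p x]) = \sum_(x | p x) prob P (X @^-1` [set x]).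
Proof.
move=> mX; rewrite (prob_total mX); last exact: discrete_rv_preimage.
rewrite [RHS]big_mkcond; apply: eq_bigr => x _; case: ifP => px.
  by congr prob; apply/seteqP; split=> [w [] //|w /= Xw]; rewrite Xw.
rewrite (_ : _ `&` _ = set0) /prob ?measure0 //.
by apply/seteqP; split=> // w [/= + Xw]; rewrite Xw px.
Qed.

(** The defining identity is tested on the whole view space. *)
Lemma cond_prob_version_cst (d' : measure_display) (S : measurableType d')
    (W : T -> S) (E : set T) (c : R) :
  cond_prob_version P W E (fun=> c) -> prob P E = c.
Proof.
case=> _ _ /(_ setT measurableT).
rewrite preimage_setT setIT integral_cst // => PE.
rewrite /prob PE [X in (_ * X)%E](_ : _ = 1%E) ?mule1 //.
exact: probability_setT.
Qed.

(* Versions of a conditional probability agree almost everywhere for the law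
   of [W], so [g] may be replaced by the constant [c] under the integral. *)
Lemma cond_independent_cst (d' : measure_display) (S : measurableType d')
    (W : T -> S) (E F : set T) (f g : S -> R) (c : R) :
    measurable_fun setT W -> measurable E ->
    cond_prob_version P W F (fun=> c) ->
    cond_prob_version P W E f -> cond_prob_version P W F g ->
    cond_prob_version P W (E `&` F) (fun s => f s * g s) ->
  prob P (E `&` F) = prob P E * c.
Proof.
(* The view space is pointed, so the pointwise bounds on the constant version can be evaluated at
   [point] to give [0 <= c <= 1]. *)
move=> mW mE [_ /(_ point) c01 Fc] [mf f01 Ef] [mg g01 Fg] [mfg fg01 EFfg].
pose W' : {mfun T >-> S} := HB.pack W (isMeasurableFun.Build _ _ _ _ _ mW).
pose Q := distribution P W'.
(* Change of variables: integrals over preimages under [W] become integrals against its law [Q],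
   where versions can be compared. *)
have intQ (h : S -> R) B : measurable B -> measurable_fun setT h ->
    (forall s, 0 <= h s <= 1) ->
    (\int[Q]_(s in B) (h s)%:E = \int[P]_(w in W @^-1` B) (h (W w))%:E)%E.
  move=> mB mh h01; rewrite ge0_integral_pushforward //.
    by apply/measurable_EFinP; apply: measurable_funTS.
  by move=> s _; rewrite lee_fin; case/andP: (h01 s).
have cg : ae_eq Q setT (fun=> c%:E) (fun s => (g s)%:E).
  apply: integral_ae_eq => //.
  - exact: finite_measure_integrable_cst.
  - exact/measurable_EFinP.
  - by move=> B _ mB; rewrite !intQ // -Fc // -Fg.
have fcg : ae_eq Q setT (fun s => (c * f s)%:E) (fun s => (f s * g s)%:E).
  by apply: filterS cg => s /(_ I) [<-] _; rewrite mulrC.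
have mT := @measurableT _ S.
have := EFfg _ mT; have := Ef _ mT.
rewrite -(intQ _ _ mT mf f01) -(intQ _ _ mT mfg fg01).
rewrite !preimage_setT !setIT => EE EFE.
rewrite /prob EFE EE.
have -> : (\int[Q]_s (f s * g s)%:E = \int[Q]_s (c * f s)%:E)%E.
  apply: ae_eq_integral => //; first exact/measurable_EFinP.
    by apply/measurable_EFinP; exact: measurable_funM.
  by apply: filterS fcg => s /[apply].
under eq_integral do rewrite EFinM.
rewrite ge0_integralZl //.
- rewrite fineM //; first exact: mulrC.
  by rewrite -EE fin_num_measure.
- exact/measurable_EFinP.
- by move=> s _; rewrite lee_fin; case/andP: (f01 s).
- by rewrite lee_fin; case/andP: c01.
Qed.

End discrete_variables.

(** * The hypergeometric law of the number of hits *)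

Lemma hypergeomE (R : realType) (L Lv t h : nat) :
    (Lv <= L)%N -> (t <= L)%N -> (h <= Lv)%N -> (h <= t)%N ->
  hypergeom L Lv t h =
    ('C(t, h) * 'C(L - t, Lv - h))%:R / 'C(L, Lv)%:R :> R.
Proof.
move=> LvL tL hLv ht; rewrite /hypergeom -natrM; apply/eqP.
rewrite eqr_div ?pnatr_eq0 -?lt0n ?bin_gt0 // -!natrM eqr_nat.
by rewrite mul_bin_hypergeometric.
Qed.

(** Outside the range one of the two binomials in the numerator vanishes. The guard [h <= t]
    matters: beyond it [t - h] truncates to zero and the weight may be positive. *)
Lemma hypergeom_eq0 (R : realType) (L Lv t h : nat) : (h <= t)%N ->
  ~~ (hmin L Lv t <= h <= hmax Lv t)%N -> hypergeom L Lv t h = 0 :> R.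
Proof.
rewrite /hmin /hmax max0n leq_min negb_and => ht out.
have /orP[hsmall|hbig] : (h < t - (L - Lv))%N || (Lv < h)%N by lia.
  by rewrite /hypergeom (@bin_small (L - Lv)) ?mulr0 ?mul0r //; lia.
by rewrite /hypergeom bin_small // !mul0r.
Qed.

Section verifier_hits_law.
Context {R : realType} {d : measure_display} {T : measurableType d}.
Variables (P : probability T R) (L Lv t : nat) (A V : T -> {set 'I_L}).
Hypotheses (LvL : (Lv <= L)%N) (tL : (t <= L)%N).
Hypotheses (mA : discrete_rv A) (mV : discrete_rv V).
Hypothesis cardA : forall w, #|A w| = t.

Lemma uniform_subset_meet (x : {set 'I_L}) (h : nat) :
    #|x| = t -> (h <= t)%N ->
  \sum_(y : {set 'I_L} | #|x :&: y| == h) uniform_subset_pmf Lv y =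
    hypergeom L Lv t h :> R.
Proof.
move=> xt ht; rewrite -big_mkcondr /=.
rewrite (eq_bigl (mem [set y : {set 'I_L} | (#|y| == Lv) &&
   (#|x :&: y| == h)]%SET)); last by move=> y; rewrite !finset.inE andbC.
(* For [h > Lv] the counting formula does not apply, but no [Lv]-subset can meet [x] in [h]
   points. *)
rewrite sumr_const; have [hLv|Lvh] := leqP h Lv; last first.
  rewrite hypergeom_eq0 //; last by rewrite /hmax; lia.
  rewrite [X in _ *+ X](_ : _ = 0%N) ?mulr0n //.
  apply/eqP; rewrite cards_eq0; apply/eqP/finset.setP => y.
  rewrite !finset.inE; apply/negbTE/negP => /andP[/eqP yLv /eqP xyh].
  have := subset_leq_card (finset.subsetIr x y); rewrite xyh yLv; lia.
by rewrite card_draws_meet // xt card_ord hypergeomE // mulr_natl.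
Qed.

(** Splitting on the value of [A], independence gives every attacked set of size [t] the same
    factor, and the probabilities of these values sum to one. *)
Lemma prob_verifier_hits (h : nat) :
    uniform_placement P Lv V -> independent_rv P A V -> (h <= t)%N ->
  prob P (verifier_hits A V h) = hypergeom L Lv t h.
Proof.
move=> unif indep ht.
have mAV := discrete_rv_pair mA mV.
rewrite (_ : verifier_hits A V h =
  (fun w => (A w, V w)) @^-1` [set p | #|p.1 :&: p.2| == h]); last first.
  by apply/seteqP; split=> w /= /eqP.
rewrite prob_bigID //.
under eq_bigr => p _.
  rewrite (_ : _ @^-1` _ = A @^-1` [set p.1] `&` V @^-1` [set p.2]); last first.
    by apply/seteqP; split=> w /=; case: p => x y /= [-> ->].
  rewrite indep unif.
  over.
rewrite -(pair_big_dep xpredT (fun x y => #|x :&: y| == h)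
  (fun x y => prob P (A @^-1` [set x]) * uniform_subset_pmf Lv y)) /=.
under eq_bigr do rewrite -mulr_sumr.
transitivity (\sum_x prob P (setT `&` A @^-1` [set x]) * hypergeom L Lv t h).
  apply: eq_bigr => x _; rewrite setTI.
  have [xt|xt] := eqVneq #|x| t; first by rewrite uniform_subset_meet.
  rewrite (_ : A @^-1` [set x] = set0) /prob ?measure0 ?mul0r //.
  by apply/seteqP; split=> // w /= Aw; rewrite -Aw cardA eqxx in xt.
rewrite -mulr_suml -prob_total // /prob probability_setT.
by rewrite mul1r.
Qed.

Lemma verifier_hits_measurable (h : nat) : measurable (verifier_hits A V h).
Proof.
have mAV := discrete_rv_pair mA mV.
exact: (discrete_rv_preimage [set p | #|p.1 :&: p.2| = h] mAV).
Qed.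

Lemma undetected_measurable (D : 'I_L -> set T) :
  (forall i, measurable (D i)) -> measurable (undetected V D).
Proof.
move=> mD; rewrite (_ : undetected V D =
  ~` \bigcup_(i in [set: 'I_L]) (V @^-1` [set v : {set _} | i \in v] `&` D i)).
  apply: measurableC; apply: fin_bigcup_measurable.
    exact: finite_finset.
  by move=> i _; apply: measurableI => //; exact: discrete_rv_preimage.
apply/seteqP; split=> [w Uw [i _ [iV Di]]|w Nw i iV Di]; first exact: (Uw i).
by apply: Nw; exists i.
Qed.

End verifier_hits_law.

(** * The non-detection bound *)

Lemma undetected_bound (R : realType) (d : measure_display)
    (T : measurableType d) (P : probability T R) (L t : nat) (q : R)
    (A V : T -> {set 'I_L}) (U : set T) :
    discrete_rv A -> discrete_rv V -> measurable U ->
    (forall w, #|A w| = t) ->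
    (forall h, 0 < prob P (verifier_hits A V h) ->
       cond_prob P U (verifier_hits A V h) <= q ^+ h) ->
  prob P U <= \sum_(0 <= h < t.+1) prob P (verifier_hits A V h) * q ^+ h.
Proof.
move=> mA mV mU cardA missed.
have mAV := discrete_rv_pair mA mV.
(* Total probability needs a finite-typed variable; since at most [t] locations are hit, [inord]
   into ['I_t.+1] merges no values. *)
have mN : discrete_rv (fun w => inord #|A w :&: V w| : 'I_t.+1).
  exact: (discrete_rv_comp (fun p => inord #|p.1 :&: p.2| : 'I_t.+1) mAV).
rewrite (prob_total P mN mU) big_mkord; apply: ler_sum => h _.
rewrite (_ : _ @^-1` _ = verifier_hits A V h); last first.
  have le_t w : (#|A w :&: V w| < t.+1)%N.
    by rewrite ltnS -(cardA w) subset_leq_card // finset.subsetIl.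
  apply/seteqP; split=> w /=; rewrite /verifier_hits /=.
    by move=> <-; rewrite inordK.
  by move=> E; apply: val_inj; rewrite /= inordK.
have := prob_ge0 P (verifier_hits A V h).
(* The bound [missed] is silent on null hit events; there monotonicity makes the term zero. *)
rewrite le_eqVlt => /orP[/eqP hits0|hits_gt0].
  rewrite -hits0 mul0r [leRHS]hits0; apply: prob_mono => //.
  - by apply: measurableI => //; exact: verifier_hits_measurable.
  - exact: verifier_hits_measurable.
by rewrite mulrC -ler_pdivrMr // missed.
Qed.

Lemma uniform_independent_of_view (R : realType) (d : measure_display)
    (T : measurableType d) (P : probability T R) (L Lv : nat)
    (d' : measure_display) (S : measurableType d') (view : T -> S)
    (A V : T -> {set 'I_L}) :
    measurable_fun setT view -> discrete_rv A ->
    uniform_placement_given P view Lv V -> cond_independent_rv P view A V ->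
  uniform_placement P Lv V /\ independent_rv P A V.
Proof.
move=> mview mA unif cind; split=> [v|x y].
  exact: cond_prob_version_cst (unif v).
have [f [g [Pf Pg Pfg]]] := cind x y.
rewrite (cond_prob_version_cst (unif y)).
exact: cond_independent_cst mview (mA x) (unif y) Pf Pg Pfg.
Qed.

Unset Implicit Arguments.
Set Strict Implicit.

Theorem proposition6p3 (R : realType)
    (d : measure_display) (T : measurableType d) (P : probability T R)
    (L Lv t : nat) (delta : R)
    (hL : (1 <= L)%N) (hLv : (Lv <= L)%N) (ht : (1 <= t <= L)%N)
    (hdelta : 0 <= delta <= 1)
    (* A: attacked set, V: hidden placement, D i: the check at i flags *)
    (A V : T -> {set 'I_L}) (D : 'I_L -> set T)
    (mA : discrete_rv A) (mV : discrete_rv V)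
    (mD : forall i, measurable (D i))
    (cardA : forall w, #|A w| = t)
    (d' : measure_display) (S : measurableType d')
    (* view: the server's view *)
    (view : T -> S) (mview : measurable_fun setT view)
    (hidden :
       (uniform_placement P Lv V /\ independent_rv P A V) \/
       (uniform_placement_given P view Lv V /\
        cond_independent_rv P view A V))
    (detect : forall i, 0 < prob P (attacked_verifier A V i) ->
       delta <= cond_prob P (D i) (attacked_verifier A V i))
    (missed : forall h, 0 < prob P (verifier_hits A V h) ->
       cond_prob P (undetected V D) (verifier_hits A V h)
         <= (1 - delta) ^+ h) :
  [/\ prob P (undetected V D) <=
        \sum_(hmin L Lv t <= h < (hmax Lv t).+1)
          hypergeom L Lv t h * (1 - delta) ^+ h,
      forall h, (hmin L Lv t <= h <= hmax Lv t)%N ->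
        prob P (verifier_hits A V h) = hypergeom L Lv t h &
      delta = 1 ->
      [/\ (t <= L - Lv)%N ->
            prob P (undetected V D) <= 'C(L - Lv, t)%:R / 'C(L, t)%:R,
          (L - Lv < t)%N -> prob P (undetected V D) = 0,
          'C(L - Lv, t)%:R / 'C(L, t)%:R =
            \prod_(0 <= j < t) ((L%:R - Lv%:R - j%:R) / (L%:R - j%:R)) :> R &
          \prod_(0 <= j < t) ((L%:R - Lv%:R - j%:R) / (L%:R - j%:R))
            <= (1 - Lv%:R / L%:R) ^+ t :> R]].
Proof.
have tL : (t <= L)%N by case/andP: ht.
have [unif indep] : uniform_placement P Lv V /\ independent_rv P A V.
  by case: hidden => // -[]; exact: uniform_independent_of_view.
have hits h : (h <= t)%N ->
    prob P (verifier_hits A V h) = hypergeom L Lv t h.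
  by move=> ?; exact: prob_verifier_hits.
have mU := undetected_measurable mV mD.
have bound : prob P (undetected V D) <=
    \sum_(hmin L Lv t <= h < (hmax Lv t).+1)
      hypergeom L Lv t h * (1 - delta) ^+ h.
  apply: (le_trans (undetected_bound mA mV mU cardA missed)).
  (* Both sums are put over [0 <= h <= t] to compare termwise; the indices added on the right carry
     zero weight. *)
  rewrite [leRHS](big_nat_widenl _ 0%N) //.
  rewrite [leRHS](big_nat_widen _ _ t.+1) ?ltnS ?geq_minl //.
  rewrite [leRHS]big_mkcond /= !big_nat; apply: ler_sum => h /=.
  rewrite ltnS => h_t.
  rewrite hits //; case: ifPn => // out.
  by rewrite hypergeom_eq0 ?mul0r // -[(h <= hmax _ _)%N]ltnS.
split=> // [h /andP[_ hle]|d1].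
  by apply: hits; rewrite (leq_trans hle) // geq_minl.
(* At [delta = 1] the miss factor is a power of zero, equal to one only for [h = 0]. *)
have hyp0 h : (0 < h)%N -> hypergeom L Lv t h * (1 - delta) ^+ h = 0.
  by move=> h0; rewrite d1 subrr expr0n gtn_eqF // mulr0.
split=> [tle|tgt| |].
- apply: (le_trans bound).
  have -> : hmin L Lv t = 0%N by rewrite /hmin; lia.
  rewrite big_nat_recl // big_nat big1 => [|h _]; last exact: hyp0.
  by rewrite addr0 expr0 mulr1 /hypergeom bin0 mul1r subn0.
(* With more attacks than data locations [hmin] is positive, so no term with [h = 0] remains. *)
- apply/eqP; rewrite eq_le prob_ge0 andbT (le_trans bound) //.
  rewrite big_nat big1 // => h /andP[hm _]; apply: hyp0.
  by move: hm; rewrite /hmin; lia.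
- by rewrite bin_ratio_prod // natrB.
- have -> : 1 - Lv%:R / L%:R = (L - Lv)%:R / L%:R :> R.
    by rewrite natrB // mulrBl divff // pnatr_eq0 -lt0n.
  by rewrite -natrB // prod_ratio_le_expr // leq_subr.
Qed.
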